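(* Let $M\in\mathbb{C}^{n\times n}$ satisfy $\mathrm{Ind}(M)\le 1$ and let $b\in\mathbb{C}^n$. Then $x=M^{\mathrm{core}}b$ is the unique solution of the constrained approximation problem $$\|Mx-b\|_F=\min\quad\text{subject to}\quad x\in\mathcal{R}(M);$$ that is, $M^{\mathrm{core}}b\in\mathcal{R}(M)$ and $M^{\mathrm{core}}b$ is the unique minimizer of $z\mapsto\|Mz-b\|_F$ over $z\in\mathcal{R}(M)$.
   Context: $\mathcal{R}(M)$ denotes the range (column space) of $M$, $\|\cdot\|_F$ the Frobenius norm (for a vector, the Euclidean norm), and $^\ast$ the conjugate transpose. The index $\mathrm{Ind}(M)$ of a singular $M\in\mathbb{C}^{n\times n}$ is the smallest positive integer $k$ with $\mathrm{rk}(M^{k+1})=\mathrm{rk}(M^k)$; the index of a nonsingular matrix is $0$. For $M\in\mathbb{C}^{n\times n}$ with $\mathrm{Ind}(M)\le 1$, the core inverse $M^{\mathrm{core}}$ is the unique matrix $X\in\mathbb{C}^{n\times n}$ satisfying $MXM=M$, $MX^2=X$ and $(MX)^\ast=MX$. *)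

(* Defs.v *)
From HB Require Import structures.
From mathcomp Require Import all_boot all_order all_algebra.
From mathcomp Require Import all_classical all_reals.
From mathcomp Require Import complex.

Set Implicit Arguments.
Unset Strict Implicit.
Unset Printing Implicit Defensive.

Import Order.TTheory GRing.Theory Num.Theory.

Local Open Scope ring_scope.
Local Open Scope complex_scope.
Local Open Scope sesquilinear_scope.

Section Index.
Variables (F : fieldType) (n : nat) (M : 'M[F]_n).

Lemma index_subproof :
  exists k, (0 < k)%N && (\rank (M ^+ k.+1) == \rank (M ^+ k)).
Proof.
apply: contrapT => noidx.
have rank_lt k : (0 < k)%N -> (\rank (M ^+ k.+1) < \rank (M ^+ k))%N.
  move=> k_gt0; rewrite ltn_neqAle; apply/andP; split.
    by apply: contra_notN noidx => eq_rk; exists k; rewrite k_gt0.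
  by rewrite exprS -mulmxE mxrankM_maxr.
have rank_drop k : (\rank (M ^+ k.+1) + k <= n)%N.
  elim: k => [|k IHk]; first by rewrite addn0 rank_leq_row.
  by rewrite addnS -addSn (leq_trans _ IHk)// leq_add2r rank_lt.
by have := rank_drop n.+1; rewrite leqNgt addnS ltnS leq_addl.
Qed.

Definition matrix_index : nat :=
  if M \in unitmx then 0%N else ex_minn index_subproof.

End Index.

Section CoreInverse.
Variables (R : realType) (n : nat).
Implicit Types M X : 'M[R[i]]_n.

Definition is_core_inverse M X : Prop :=
  [/\ M *m X *m M = M, M *m (X *m X) = X & (M *m X)^t* = M *m X].

(* The three equations determine X when matrix_index M <= 1; for matrices
   without a core inverse the value is the junk value 0. *)
Definition core_inverse M : 'M[R[i]]_n :=
  xget 0 [set X | is_core_inverse M X].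

End CoreInverse.

Section ConstrainedApproximation.
Variable R : realType.

Definition frobenius_norm m n (A : 'M[R[i]]_(m, n)) : R :=
  Num.sqrt (\sum_(i < m) \sum_(j < n) Normc.normc (A i j) ^+ 2).

Definition column_space m n (A : 'M[R[i]]_(m, n)) : set 'cV[R[i]]_m :=
  range (fun y : 'cV[R[i]]_n => A *m y).

Definition constrained_minimizer n (M : 'M[R[i]]_n) (b x : 'cV[R[i]]_n) : Prop :=
  column_space M x /\
  forall z : 'cV[R[i]]_n, column_space M z ->
    frobenius_norm (M *m x - b) <= frobenius_norm (M *m z - b).

End ConstrainedApproximation.

(* Main.v *)
Require Import Defs.
From mathcomp Require Import all_boot all_order all_algebra.
From mathcomp Require Import all_classical all_reals.
From mathcomp Require Import complex.

(** Write X for the core inverse.  Its equations say that P = M X is Hermitian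
    and satisfies P M = M, so P is the orthogonal projector onto the range of M,
    and P b is the point of that range closest to b.  Since X = M X X, the vector
    X b lies in the range of M, and M (X b) = P b; hence X b attains the minimum
    of |M z - b| even among all vectors z, constrained or not.  By Pythagoras
    any other minimizer z has the same image M z = P b, and index at most 1 makes
    M injective on its own range ([mulmx_range_inj]), which yields uniqueness.

    As [core_inverse M] is a choice among the solutions of the three equations,
    a solution has to be exhibited ([core_inverse_exists]).
    Positive definiteness gives [gram_eq0], hence that M and its Gram matrix
    have the same row space; this produces the orthogonal projector in the form
    P = M W ([range_projector]).  Index at most 1 gives M = M M Z
    ([index_le1_factor]), and X = M Z W is then a core inverse. *)

Import Order.TTheory GRing.Theory Num.Theory.

Local Open Scope ring_scope.
Local Open Scope complex_scope.
Local Open Scope sesquilinear_scope.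

Lemma trmxC_mul (C : numClosedFieldType) m n p
    (A : 'M[C]_(m, n)) (B : 'M[C]_(n, p)) :
  (A *m B)^t* = B^t* *m A^t*.
Proof. by rewrite trmx_mul map_mxM. Qed.

Lemma trmxCD (C : numClosedFieldType) m n (A B : 'M[C]_(m, n)) :
  (A + B)^t* = A^t* + B^t*.
Proof. by rewrite linearD map_mxD. Qed.

Section FrobeniusNorm.
Variable R : realType.

Lemma frobenius_norm_ge0 m n (A : 'M[R[i]]_(m, n)) : 0 <= frobenius_norm A.
Proof. exact: sqrtr_ge0. Qed.

Lemma frobenius_norm_sqr m n (A : 'M[R[i]]_(m, n)) :
  frobenius_norm A ^+ 2 =
    \sum_(i < m) \sum_(j < n) Normc.normc (A i j) ^+ 2.
Proof.
by rewrite sqr_sqrtr// sumr_ge0// => i _; rewrite sumr_ge0// => j _; exact: sqr_ge0.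
Qed.

(** The Gram form turns orthogonality of ranges into a matrix equation, which is
    how Pythagoras and positive definiteness are obtained below. *)
Lemma frobenius_norm_gram m n (A : 'M[R[i]]_(m, n)) :
  (frobenius_norm A ^+ 2)%:C = \tr (A^t* *m A).
Proof.
rewrite frobenius_norm_sqr exchange_big /mxtrace rmorph_sum; apply: eq_bigr => j _.
rewrite mxE rmorph_sum; apply: eq_bigr => i _.
have normcE (z : R[i]) : (Normc.normc z)%:C = `|z| by [].
by rewrite !mxE rmorphXn/= normcE normCK mulrC.
Qed.

Lemma frobenius_norm_eq0 m n (A : 'M[R[i]]_(m, n)) :
  frobenius_norm A = 0 -> A = 0.
Proof.
move=> A0; have := frobenius_norm_sqr _ _ A; rewrite A0 expr0n => /esym/eqP.
rewrite psumr_eq0; last by move=> i _; rewrite sumr_ge0// => j _; rewrite sqr_ge0.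
move=> /allP sumA0; apply/matrixP => i j; rewrite mxE.
have := sumA0 i (mem_index_enum _).
rewrite psumr_eq0; last by move=> k _; rewrite sqr_ge0.
move=> /allP/(_ j (mem_index_enum _)); rewrite sqrf_eq0 => /eqP.
exact: Normc.eq0_normc.
Qed.

Lemma gram_eq0 m n (A : 'M[R[i]]_(m, n)) : A^t* *m A = 0 -> A = 0.
Proof.
move=> A0; apply: frobenius_norm_eq0; apply/eqP; rewrite -sqrf_eq0.
have /eqP := frobenius_norm_gram _ _ A.
by rewrite A0 mxtrace0 -(rmorph0 (real_complex R)) (inj_eq (@complexI R)).
Qed.

Lemma frobenius_pythagoras m n (A B : 'M[R[i]]_(m, n)) :
  A^t* *m B = 0 ->
  frobenius_norm (A + B) ^+ 2 = frobenius_norm A ^+ 2 + frobenius_norm B ^+ 2.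
Proof.
move=> AB0; apply: (@complexI R); rewrite rmorphD/= !frobenius_norm_gram.
have BA0 : B^t* *m A = 0.
  by rewrite -[A]trmxCK -trmxC_mul AB0 trmx0 map_mx0.
by rewrite trmxCD mulmxDl !mulmxDr AB0 BA0 addr0 add0r linearD.
Qed.

End FrobeniusNorm.

Section IndexLe1.
Variables (F : fieldType) (n : nat).
Implicit Type M : 'M[F]_n.

Lemma rank_sqr_index_le1 M : (matrix_index M <= 1)%N -> \rank (M *m M) = \rank M.
Proof.
rewrite /matrix_index; case: ifPn => [M_unit _|_].
  by rewrite mxrankMfree// row_free_unit.
by case: ex_minnP => -[|[|k]]// /andP[_ /eqP rkM] _ _.
Qed.

(** The row space of M M lies in that of M, and its column space in that of M;
    as the ranks agree, both inclusions are equalities. *)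
Lemma index_le1_factor M :
  (matrix_index M <= 1)%N ->
  (exists Y, M = Y *m (M *m M)) /\ (exists Z, M = M *m M *m Z).
Proof.
move=> /rank_sqr_index_le1 rkM; split.
  apply/submxP; have := mxrank_leqif_eq (submxMl M M).
  by move=> /geq_leqif; rewrite rkM leqnn => /esym/andP[].
have := mxrank_leqif_eq (submxMl M^T M^T).
move=> /geq_leqif; rewrite -trmx_mul !mxrank_tr rkM leqnn => /esym/andP[_].
by move=> /submxP[Z MZ]; exists Z^T; apply: trmx_inj; rewrite trmx_mul trmxK.
Qed.

(** Writing M = Y M M, the factor Y undoes the action of M on its range. *)
Lemma mulmx_range_inj M p (y : 'M[F]_(n, p)) :
  (matrix_index M <= 1)%N -> M *m (M *m y) = 0 -> M *m y = 0.
Proof.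
move=> /index_le1_factor[[Y MY] _] MMy.
by rewrite MY -!mulmxA MMy mulmx0.
Qed.

End IndexLe1.

Section CoreInverseExistence.
Variable R : realType.

(** M and its Gram matrix have the same row space, so M = Y M^* M; then
    P = Y M^* fixes M, and P P^* = P^* makes P Hermitian. *)
Lemma range_projector m n (M : 'M[R[i]]_(m, n)) :
  exists W, (M *m W)^t* = M *m W /\ M *m W *m M = M.
Proof.
have /submxP[Y MY] : (M <= M^t* *m M)%MS.
  rewrite submxE; apply/eqP/gram_eq0.
  by rewrite trmxC_mul -mulmxA (mulmxA (M^t*) M) mulmx_coker mulmx0.
pose P := Y *m M^t*.
have PM : P *m M = M by rewrite -mulmxA -MY.
have PadjE : P^t* = M *m Y^t* by rewrite trmxC_mul trmxCK.
have PPadj : P *m P^t* = P^t* by rewrite PadjE mulmxA PM.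
have Pherm : P^t* = P.
  by have := congr1 (fun A => A^t*) PPadj; rewrite trmxC_mul trmxCK PPadj.
by exists (Y^t*); rewrite -PadjE trmxCK Pherm PM.
Qed.

Lemma core_inverse_exists n (M : 'M[R[i]]_n) :
  (matrix_index M <= 1)%N -> exists X, is_core_inverse M X.
Proof.
move=> /index_le1_factor[_ [Z MZ]].
have [W [Pherm PM]] := range_projector _ _ M.
have MX : M *m (M *m Z *m W) = M *m W by rewrite !mulmxA -MZ.
exists (M *m Z *m W); split; rewrite ?MX//.
by rewrite mulmxA MX !mulmxA PM.
Qed.

Lemma core_inverseP n (M : 'M[R[i]]_n) :
  (matrix_index M <= 1)%N -> is_core_inverse M (core_inverse M).
Proof. by move=> /core_inverse_exists; apply: xgetPex. Qed.

(** The residual of X b is orthogonal to the range of M, so every z has the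
    residual of X b as one leg of a right triangle. *)
Lemma core_inverse_residual n (M X : 'M[R[i]]_n) (b z : 'cV[R[i]]_n) :
  is_core_inverse M X ->
  frobenius_norm (M *m z - b) ^+ 2 =
    frobenius_norm (M *m (z - X *m b)) ^+ 2 +
    frobenius_norm (M *m (X *m b) - b) ^+ 2.
Proof.
move=> [MXM _ MXherm]; rewrite -frobenius_pythagoras.
  by rewrite mulmxBr addrA subrK.
have adjM : M^t* *m (M *m X) = M^t*.
  by rewrite -[in LHS]MXherm -trmxC_mul MXM.
rewrite trmxC_mul -mulmxA mulmxBr [M *m _]mulmxA [M^t* *m _]mulmxA adjM.
by rewrite subrr mulmx0.
Qed.

End CoreInverseExistence.

Theorem theorem3p1 (R : realType) (n : nat) (M : 'M[R[i]]_n) (b : 'cV[R[i]]_n)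
    (indM : (matrix_index M <= 1)%N) :
  constrained_minimizer M b (core_inverse M *m b) /\
  (forall x : 'cV[R[i]]_n,
     constrained_minimizer M b x -> x = core_inverse M *m b).
Proof.
have coreM := core_inverseP _ _ _ indM; set X := core_inverse M in coreM *.
have residual z := core_inverse_residual _ _ _ _ b z coreM.
have Xb_range : X *m b = M *m (X *m X *m b).
  by case: coreM => _ MXX _; rewrite [in RHS]mulmxA MXX.
have Xb_col : column_space M (X *m b) by exists (X *m X *m b).
split=> [|x [[y _ xE] x_min]].
  split=> // z _.
  by rewrite -ler_sqr ?nnegrE ?frobenius_norm_ge0// (residual z) lerDr sqr_ge0.
have := x_min _ Xb_col.
rewrite -ler_sqr ?nnegrE ?frobenius_norm_ge0// (residual x) gerDr.
move=> leg_le0.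
have /frobenius_norm_eq0 : frobenius_norm (M *m (x - X *m b)) = 0.
  by apply/eqP; rewrite -sqrf_eq0 eq_le leg_le0 sqr_ge0.
rewrite -xE Xb_range -mulmxBr => /(mulmx_range_inj _ _ _ _ _ indM).
by rewrite mulmxBr => /eqP; rewrite subr_eq0 => /eqP.
Qed.
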